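(* For $i=1,2,3$ let $\mathcal L(\mathbf D_i)$ denote the extension of the logic $\mathcal{DMBSH}$ corresponding to the variety $\mathbb V(\mathbf D_i)$. Then, as axiomatic extensions of $\mathcal{DMBSH}$: (1) $\mathcal L(\mathbf D_1)$ is defined by the axiom $(\bot\to\top)\to_H\bot$; (2) $\mathcal L(\mathbf D_2)$ is defined by the axiom $\bot\to\top$; (3) $\mathcal L(\mathbf D_3)$ is defined by the axiom ${\sim}(\bot\to\top)\Leftrightarrow_H(\bot\to\top)$.
   Context: Language: $\langle\vee,\wedge,\to,\sim,\bot,\top\rangle$ of arities $2,2,2,1,0,0$. $\alpha\to_H\beta$ abbreviates $\alpha\to(\alpha\wedge\beta)$ and $\alpha\Leftrightarrow_H\beta$ abbreviates $(\alpha\to_H\beta)\wedge(\beta\to_H\alpha)$. The logic $\mathcal{DHMSH}$ is the Hilbert-style logic with axiom schemes: (A1) $\alpha\to_H(\alpha\vee\beta)$; (A2) $\beta\to_H(\alpha\vee\beta)$; (A3) $(\alpha\to_H\gamma)\to_H[(\beta\to_H\gamma)\to_H((\alpha\vee\beta)\to_H\gamma)]$; (A4) $(\alpha\wedge\beta)\to_H\alpha$; (A5) $(\gamma\to_H\alpha)\to_H[(\gamma\to_H\beta)\to_H(\gamma\to_H(\alpha\wedge\beta))]$; (A6) $\top$; (A7) $\bot\to_H\alpha$; (A8) $((\alpha\wedge\beta)\to_H\gamma)\to_H(\alpha\to_H(\beta\to_H\gamma))$; (A9) $(\alpha\to_H(\beta\to_H\gamma))\to_H((\alpha\wedge\beta)\to_H\gamma)$;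 (A10) $(\alpha\to_H\beta)\to_H((\beta\to_H\alpha)\to_H((\alpha\to\gamma)\to_H(\beta\to\gamma)))$; (A11) $(\alpha\to_H\beta)\to_H((\beta\to_H\alpha)\to_H((\gamma\to\beta)\to_H(\gamma\to\alpha)))$; (A12) $\top\to_H{\sim}\bot$; (A13) ${\sim}\top\to_H\bot$; (A14) ${\sim}(\alpha\wedge\beta)\to_H({\sim}\alpha\vee{\sim}\beta)$; and rules (SMP): from $\phi$ and $\phi\to_H\gamma$ deduce $\gamma$; (SCP): from $\phi\to_H\gamma$ deduce ${\sim}\gamma\to_H{\sim}\phi$ (both applicable to any formulas derived from the premises). An axiomatic extension is obtained by adjoining new axiom schemes and keeping the same rules. A semi-Heyting algebra is an algebra $\langle L,\vee,\wedge,\to,0,1\rangle$ such that $\langle L,\vee,\wedge,0,1\rangle$ is a lattice with $0$ and $1$, and $x\wedge(x\to y)\approx x\wedge y$, $x\wedge(y\to z)\approx x\wedge[(x\wedge y)\to(x\wedge z)]$, $x\to x\approx1$. $\mathbb{DHMSH}$ is the variety of algebras $\langle A,\vee,\wedge,\to,{}',0,1\rangle$ such that $\langle A,\vee,\wedge,\to,0,1\rangle$ is a semi-Heyting algebra and $0'\approx1$, $1'\approx0$, $(x\wedge y)'\approx x'\vee y'$. Formulas are interpreted with $\sim,\bot,\top$ as ${}',0,1$. The logic corresponding to a subvariety $\mathbb V$ of $\mathbb{DHMSH}$ is the unique axiomatic extension $\mathcal E$ of $\mathcal{DHMSH}$ such that $\mathbb V=\{\mathbf A\in\mathbb{DHMSH}:\mathbf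 A\models\delta\approx1\text{ for every theorem }\delta\text{ of }\mathcal E\}$. $\mathbb{DMBSH}$ is the variety of De Morgan Boolean semi-Heyting algebras: members of $\mathbb{DHMSH}$ with $(x\vee y)'\approx x'\wedge y'$, $x''\approx x$ and $x\vee(x\to0)\approx1$; $\mathcal{DMBSH}$ is the corresponding logic. $\mathbf D_1,\mathbf D_2,\mathbf D_3$ are algebras on the four-element Boolean lattice $\{0,a,b,1\}$ ($b$ the complement of $a$) with $0'=1$, $1'=0$, $a'=a$, $b'=b$. Their operations $\to$ are given by rows $x\to0,\ x\to1,\ x\to a,\ x\to b$: $\mathbf D_1$: $x=0$: $1,0,b,a$; $x=1$: $0,1,a,b$; $x=a$: $b,a,1,0$; $x=b$: $a,b,0,1$. $\mathbf D_2$: $x=0$: $1,1,1,1$; $x=1$: $0,1,a,b$; $x=a$: $b,1,1,b$; $x=b$: $a,1,a,1$. $\mathbf D_3$: $x=0$: $1,a,1,a$; $x=1$: $0,1,a,b$; $x=a$: $b,a,1,0$; $x=b$: $a,1,a,1$. $\mathbb V(\cdot)$ denotes the generated variety. *)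

(* Defs.v *)
From mathcomp Require Import all_boot classical_sets.

Set Implicit Arguments.
Unset Strict Implicit.
Unset Printing Implicit Defensive.

Local Open Scope classical_set_scope.

Inductive form : Set :=
| Var : nat -> form
| For : form -> form -> form
| Fand : form -> form -> form
| Fimp : form -> form -> form
| Fneg : form -> form
| Fbot : form
| Ftop : form.

Declare Scope form_scope.
Delimit Scope form_scope with F.
Bind Scope form_scope with form.

Notation "∼ x" := (Fneg x) (at level 35, right associativity) : form_scope.
Notation "x ∧ y" := (Fand x y) (at level 40, left associativity) : form_scope.
Notation "x ∨ y" := (For x y) (at level 50, left associativity) : form_scope.
Notation "x → y" := (Fimp x y) (at level 60, right associativity) : form_scope.
Notation "⊥" := Fbot : form_scope.
Notation "⊤" := Ftop : form_scope.

Definition FimpH (x y : form) : form := (x → (x ∧ y))%F.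
Notation "x →H y" := (FimpH x y) (at level 60, right associativity) : form_scope.

Definition FiffH (x y : form) : form := ((x →H y) ∧ (y →H x))%F.
Notation "x ⇔H y" := (FiffH x y) (at level 65, no associativity) : form_scope.

Fixpoint subst (s : nat -> form) (x : form) : form :=
  match x with
  | Var n => s n
  | x ∨ y => subst s x ∨ subst s y
  | x ∧ y => subst s x ∧ subst s y
  | x → y => subst s x → subst s y
  | ∼ x => ∼ subst s x
  | ⊥ => ⊥
  | ⊤ => ⊤
  end%F.

(* A logic is given by its consequence operator: [L G p] reads "G |- p". *)
Definition logic := set form -> set form.

Inductive DHMSH_axiom : set form :=
| A1 a b : DHMSH_axiom (a →H (a ∨ b))
| A2 a b : DHMSH_axiom (b →H (a ∨ b))
| A3 a b c : DHMSH_axiom ((a →H c) →H ((b →H c) →H ((a ∨ b) →H c)))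
| A4 a b : DHMSH_axiom ((a ∧ b) →H a)
| A5 a b c : DHMSH_axiom ((c →H a) →H ((c →H b) →H (c →H (a ∧ b))))
| A6 : DHMSH_axiom ⊤
| A7 a : DHMSH_axiom (⊥ →H a)
| A8 a b c : DHMSH_axiom (((a ∧ b) →H c) →H (a →H (b →H c)))
| A9 a b c : DHMSH_axiom ((a →H (b →H c)) →H ((a ∧ b) →H c))
| A10 a b c :
    DHMSH_axiom ((a →H b) →H ((b →H a) →H ((a → c) →H (b → c))))
| A11 a b c :
    DHMSH_axiom ((a →H b) →H ((b →H a) →H ((c → b) →H (c → a))))
| A12 : DHMSH_axiom (⊤ →H ∼ ⊥)
| A13 : DHMSH_axiom (∼ ⊤ →H ⊥)
| A14 a b : DHMSH_axiom (∼ (a ∧ b) →H (∼ a ∨ ∼ b)).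

Inductive derives (Ax G : set form) : set form :=
| Daxiom p : Ax p -> derives Ax G p
| Dpremise p : G p -> derives Ax G p
| SMP p q : derives Ax G p -> derives Ax G (p →H q) -> derives Ax G q
| SCP p q : derives Ax G (p →H q) -> derives Ax G (∼ q →H ∼ p).

Definition DHMSH_logic : logic := derives DHMSH_axiom.

Definition theorems (L : logic) : set form := L set0.

Definition instances (X : set form) : set form :=
  [set p | exists s x, X x /\ p = subst s x].

(* The extension of [L] by the axiom schemes [X], with the same rules.  As [L]
   is given without a chosen axiomatization, its theorems serve as axioms; the
   rules of every axiomatic extension of DHMSH are SMP and SCP. *)
Definition adjoin (L : logic) (X : set form) : logic :=
  derives (theorems L `|` instances X).

Definition is_axiomatic_extension (L E : logic) : Prop :=
  exists X : set form, E = adjoin L X.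

Record algebra := Algebra {
  carrier :> Type;
  ajoin : carrier -> carrier -> carrier;
  ameet : carrier -> carrier -> carrier;
  aimp : carrier -> carrier -> carrier;
  aneg : carrier -> carrier;
  azero : carrier;
  aone : carrier
}.

Arguments azero {a}.
Arguments aone {a}.

Fixpoint eval (A : algebra) (v : nat -> A) (x : form) : A :=
  match x with
  | Var n => v n
  | x ∨ y => ajoin (eval v x) (eval v y)
  | x ∧ y => ameet (eval v x) (eval v y)
  | x → y => aimp (eval v x) (eval v y)
  | ∼ x => aneg (eval v x)
  | ⊥ => azero
  | ⊤ => aone
  end%F.

Definition satisfies_eq (A : algebra) (x y : form) : Prop :=
  forall v : nat -> A, eval v x = eval v y.

Record semiHeyting (A : algebra) : Prop := {
  joinC : forall x y : A, ajoin x y = ajoin y x;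
  meetC : forall x y : A, ameet x y = ameet y x;
  joinA : forall x y z : A, ajoin x (ajoin y z) = ajoin (ajoin x y) z;
  meetA : forall x y z : A, ameet x (ameet y z) = ameet (ameet x y) z;
  joinKI : forall x y : A, ajoin x (ameet x y) = x;
  meetKU : forall x y : A, ameet x (ajoin x y) = x;
  join0 : forall x : A, ajoin x azero = x;
  meet1 : forall x : A, ameet x aone = x;
  meet_imp : forall x y : A, ameet x (aimp x y) = ameet x y;
  meet_imp_rel : forall x y z : A,
    ameet x (aimp y z) = ameet x (aimp (ameet x y) (ameet x z));
  imp_refl : forall x : A, aimp x x = aone
}.

Record DHMSH (A : algebra) : Prop := {
  DHMSH_semiHeyting : semiHeyting A;
  neg0 : aneg azero = aone :> A;
  neg1 : aneg aone = azero :> A;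
  neg_meet : forall x y : A, aneg (ameet x y) = ajoin (aneg x) (aneg y)
}.

Record DMBSH (A : algebra) : Prop := {
  DMBSH_DHMSH : DHMSH A;
  neg_join : forall x y : A, aneg (ajoin x y) = ameet (aneg x) (aneg y);
  negK : forall x : A, aneg (aneg x) = x;
  join_compl : forall x : A, ajoin x (aimp x azero) = aone
}.

Record hom (A B : algebra) (f : A -> B) : Prop := {
  hom_join : forall x y, f (ajoin x y) = ajoin (f x) (f y);
  hom_meet : forall x y, f (ameet x y) = ameet (f x) (f y);
  hom_imp : forall x y, f (aimp x y) = aimp (f x) (f y);
  hom_neg : forall x, f (aneg x) = aneg (f x);
  hom_zero : f azero = azero;
  hom_one : f aone = aone
}.

Definition prod_algebra (I : Type) (A : I -> algebra) : algebra := {|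
  carrier := forall i, A i;
  ajoin x y := fun i => ajoin (x i) (y i);
  ameet x y := fun i => ameet (x i) (y i);
  aimp x y := fun i => aimp (x i) (y i);
  aneg x := fun i => aneg (x i);
  azero := fun i => azero;
  aone := fun i => aone
|}.

(* Closure under subalgebras is stated with embeddings, so that it includes
   closure under isomorphism. *)
Record variety (K : algebra -> Prop) : Prop := {
  closed_image : forall (A B : algebra) (f : A -> B),
    hom f -> (forall y, exists x, f x = y) -> K A -> K B;
  closed_sub : forall (A B : algebra) (f : A -> B),
    hom f -> injective f -> K B -> K A;
  closed_prod : forall (I : Type) (A : I -> algebra),
    (forall i, K (A i)) -> K (prod_algebra A)
}.

Definition generated_variety (D A : algebra) : Prop :=
  forall K, variety K -> K D -> K A.

Definition corresponds (V : algebra -> Prop) (E : logic) : Prop :=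
  is_axiomatic_extension DHMSH_logic E /\
  forall A, V A <->
    DHMSH A /\ forall d, theorems E d -> satisfies_eq A d ⊤%F.

Definition is_logic_of (V : algebra -> Prop) (E : logic) : Prop :=
  unique (corresponds V) E.

Inductive four : Set := e0 | e1 | ea | eb.

Definition four_meet (x y : four) : four :=
  match x, y with
  | e1, z | z, e1 => z
  | ea, ea => ea
  | eb, eb => eb
  | _, _ => e0
  end.

Definition four_join (x y : four) : four :=
  match x, y with
  | e0, z | z, e0 => z
  | ea, ea => ea
  | eb, eb => eb
  | _, _ => e1
  end.

Definition four_neg (x : four) : four :=
  match x with e0 => e1 | e1 => e0 | ea => ea | eb => eb end.

Definition four_row (z0 z1 za zb y : four) : four :=
  match y with e0 => z0 | e1 => z1 | ea => za | eb => zb end.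

Definition four_algebra (imp : four -> four -> four) : algebra := {|
  carrier := four;
  ajoin := four_join;
  ameet := four_meet;
  aimp := imp;
  aneg := four_neg;
  azero := e0;
  aone := e1
|}.

(* Columns are in the order 0, 1, a, b. *)
Definition D1 : algebra := four_algebra (fun x =>
  match x with
  | e0 => four_row e1 e0 eb ea
  | e1 => four_row e0 e1 ea eb
  | ea => four_row eb ea e1 e0
  | eb => four_row ea eb e0 e1
  end).

Definition D2 : algebra := four_algebra (fun x =>
  match x with
  | e0 => four_row e1 e1 e1 e1
  | e1 => four_row e0 e1 ea eb
  | ea => four_row eb e1 e1 eb
  | eb => four_row ea e1 ea e1
  end).

Definition D3 : algebra := four_algebra (fun x =>
  match x with
  | e0 => four_row e1 ea e1 ea
  | e1 => four_row e0 e1 ea eb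
  | ea => four_row eb ea e1 e0
  | eb => four_row ea e1 ea e1
  end).

(* Main.v *)
Require Import Defs.
From mathcomp Require Import all_boot boolp classical_sets.

(** The statement combines a bridge between extensions and classes of algebras
    with a description of the De Morgan Boolean algebras.

    The bridge. In a semi-Heyting algebra, [x ⇒ x ⊓ y] is the residual of the
    meet, so the axioms are sound and [p ⇔H q] takes the value 1 exactly when
    [p] and [q] take the same value. Conversely, in any set of formulas that
    contains the axioms and is closed under the two rules, provable equivalence
    is a congruence whose quotient, the Lindenbaum algebra, lies in DHMSH
    ([lindenbaum_DHMSH]). If two axiomatic extensions have the same models, the
    Lindenbaum algebra of each is a model of the other; so they have the same
    theorems, and hence the same consequence operator. Therefore a class cut out
    of DHMSH by the validity of a set of formulas has as its logic the extension
    by these formulas ([is_logic_of_adjoin]). What remains is that the members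
    of DMBSH that satisfy each of the three axioms form the variety generated by
    [D1], [D2] and [D3] respectively ([is_logic_of_generated]).

    The algebras. Put [c = 0 ⇒ 1]. In a Boolean semi-Heyting algebra the
    implication is the Boolean term: if [x] then [y] else ([y] implies [c])
    ([char_imp]); and the De Morgan negation followed by the complement is an
    automorphism of order two of the Boolean reduct. The axioms say [c = 0],
    [c = 1] and [c' = c]. A prime filter with indicator function [h] gives a
    second one, [x ↦ ~~ h x'], and the pair of the two is a map into the
    four-element Boolean lattice, on which the automorphism swaps the two
    coordinates. This map preserves all operations as soon as it sends [c] to
    the value of [0 ⇒ 1] in the four-element algebra ([char_map_hom]): this is
    automatic in the first two cases, and in the third it holds for [h] or for
    its dual. Prime filters separate points, so the algebra embeds in a power of
    [Di] ([four_generated]). *)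

Local Open Scope classical_set_scope.

Set Implicit Arguments.
Unset Strict Implicit.
Unset Printing Implicit Defensive.

Local Notation "x ⊓ y" := (ameet x y) (at level 40, left associativity).
Local Notation "x ⊔ y" := (ajoin x y) (at level 50, left associativity).
Local Notation "x ⇒ y" := (aimp x y) (at level 60, right associativity).

(** * Semi-Heyting algebras *)

(** The lattice order. *)
Definition le (A : algebra) (x y : A) : Prop := x ⊓ y = x.

Local Notation "x ≼ y" := (le x y) (at level 70, no associativity).

(** The Heyting implication of a semi-Heyting algebra; [FimpH] is interpreted
    by it. *)
Definition impH (A : algebra) (x y : A) : A := x ⇒ x ⊓ y.

Section SemiHeyting.
Variables (A : algebra) (H : semiHeyting A).
Implicit Types x y z t : A.

Lemma meetxx x : x ⊓ x = x.
Proof. by have := meetKU H x (x ⊓ x); rewrite (joinKI H). Qed.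

Lemma le_refl x : x ≼ x. Proof. exact: meetxx. Qed.

Lemma le_trans y x z : x ≼ y -> y ≼ z -> x ≼ z.
Proof. by rewrite /le => xy yz; rewrite -{1}xy -(meetA H) yz. Qed.

Lemma le_anti x y : x ≼ y -> y ≼ x -> x = y.
Proof. by rewrite /le (meetC H y) => -> ->. Qed.

Lemma le_meetl x y : x ⊓ y ≼ x.
Proof. by rewrite /le (meetC H x) -(meetA H) meetxx. Qed.

Lemma le_meetr x y : x ⊓ y ≼ y.
Proof. by rewrite /le -(meetA H) meetxx. Qed.

Lemma le_meet x y z : z ≼ x -> z ≼ y -> z ≼ x ⊓ y.
Proof. by rewrite /le (meetA H) => -> ->. Qed.

Lemma le_joinl x y : x ≼ x ⊔ y. Proof. exact: meetKU. Qed.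

Lemma le_joinr x y : y ≼ x ⊔ y.
Proof. by rewrite (joinC H); exact: le_joinl. Qed.

Lemma le_joinE x y : x ≼ y <-> x ⊔ y = y.
Proof.
rewrite /le; split=> [<-|<-]; last exact: meetKU.
by rewrite (joinC H) (meetC H) (joinKI H).
Qed.

Lemma join_le x y z : x ≼ z -> y ≼ z -> x ⊔ y ≼ z.
Proof. by rewrite !le_joinE -(joinA H) => xz ->. Qed.

Lemma le0x x : azero ≼ x.
Proof. by apply/le_joinE; rewrite (joinC H) (join0 H). Qed.

Lemma lex1 x : x ≼ aone. Proof. exact: meet1. Qed.

Lemma le1_eq x : aone ≼ x -> x = aone.
Proof. by move=> h; apply: le_anti => //; exact: lex1. Qed.

Lemma meet1x x : aone ⊓ x = x. Proof. by rewrite (meetC H) (meet1 H). Qed.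

Lemma meetx0 x : x ⊓ azero = azero. Proof. by rewrite (meetC H); exact: le0x. Qed.

Lemma residuation x y z : z ≼ impH x y <-> z ⊓ x ≼ y.
Proof.
split=> h; last first.
  rewrite /le /impH (meet_imp_rel H z) (meetA H) h (imp_refl H).
  exact: meet1.
apply: (@le_trans (x ⊓ (x ⇒ x ⊓ y))); last first.
  by rewrite (meet_imp H); apply: le_trans (le_meetr _ _) (le_meetr _ _).
apply: le_meet; first exact: le_meetr.
exact: le_trans (le_meetl _ _) h.
Qed.

Lemma impH_eq1 x y : impH x y = aone <-> x ≼ y.
Proof.
rewrite -(meet1x x) -residuation meet1x; split=> [->|]; first exact: le_refl.
exact: le1_eq.
Qed.

Lemma meet_eq1 x y : x ⊓ y = aone <-> x = aone /\ y = aone.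
Proof.
split=> [xy|[-> ->]]; last exact: meetxx.
by split; apply: le1_eq; rewrite -xy; [exact: le_meetl|exact: le_meetr].
Qed.

Lemma impH_mp x y z : z ≼ x -> z ≼ impH x y -> z ≼ y.
Proof.
by move=> zx /residuation; apply: le_trans; apply: le_meet => //; exact: le_refl.
Qed.

(* Distributivity, which residuation gives. *)
Lemma meet_join_le x y z t : t ⊓ x ≼ z -> t ⊓ y ≼ z -> t ⊓ (x ⊔ y) ≼ z.
Proof.
rewrite !(meetC H t) => /residuation xz /residuation yz.
by apply/residuation; exact: join_le.
Qed.

(** The part of an implication below [z] depends only on the parts of its
    arguments below [z]. *)
Lemma imp_relE x x' y y' z :
  z ⊓ x = z ⊓ x' -> z ⊓ y = z ⊓ y' -> z ⊓ (x ⇒ y) = z ⊓ (x' ⇒ y').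
Proof.
by move=> ex ey; rewrite (meet_imp_rel H z x) (meet_imp_rel H z x') ex ey.
Qed.

Lemma impH_meetE x y z : z ≼ impH x y -> z ≼ impH y x -> z ⊓ x = z ⊓ y.
Proof.
move=> /residuation xy /residuation yx.
by apply: le_anti; apply: le_meet => //; exact: le_meetl.
Qed.

End SemiHeyting.

(** * Soundness *)

Section Soundness.
Variables (A : algebra) (H : DHMSH A).
Let SH : semiHeyting A := DHMSH_semiHeyting H.
Implicit Types (v : nat -> A) (p q : form).

Lemma neg_anti (x y : A) : x ≼ y -> aneg y ≼ aneg x.
Proof. by rewrite {1}/le => <-; rewrite (neg_meet H) (joinC SH); exact: le_joinl. Qed.

Lemma eval_impH v p q : eval v (p →H q) = impH (eval v p) (eval v q).
Proof. by []. Qed.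

Lemma eval_iffH_eq1 v p q : eval v (p ⇔H q)%F = aone <-> eval v p = eval v q.
Proof.
rewrite /= -!/(impH _ _) (meet_eq1 SH) !(impH_eq1 SH).
by split=> [[]|->]; [exact: le_anti|split; exact: le_refl].
Qed.

Lemma DHMSH_axiom_sound p : DHMSH_axiom p -> satisfies_eq A p ⊤%F.
Proof.
have wk (x y z : A) : x ≼ y -> z ⊓ x ≼ y.
  by move=> xy; apply: (le_trans SH _ xy); exact: le_meetr.
have wkl (x y z : A) : x ≼ y -> x ⊓ z ≼ y.
  by move=> xy; apply: (le_trans SH _ xy); exact: le_meetl.
have mpx (x y : A) : impH x y ⊓ x ≼ y by apply/(residuation SH); exact: le_refl.
case=> [a b|a b|a b c|a b|a b c||a|a b c|a b c|a b c|a b c|||a b] v //=;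
  rewrite -?/(impH _ _); try apply/(impH_eq1 SH).
- exact: le_joinl.
- exact: le_joinr.
- apply/(residuation SH)/(residuation SH); apply: (meet_join_le SH).
    apply: (impH_mp SH (x := eval v a)); first exact: le_meetr.
    by apply: (wkl); apply: (wkl); exact: le_refl.
  apply: (impH_mp SH (x := eval v b)); first exact: le_meetr.
  by apply: (wkl); apply: (wk); exact: le_refl.
- exact: le_meetl.
- apply/(residuation SH)/(residuation SH); apply: le_meet => //.
    apply: (impH_mp SH (x := eval v c)); first exact: le_meetr.
    by apply: (wkl); apply: (wkl); exact: le_refl.
  apply: (impH_mp SH (x := eval v c)); first exact: le_meetr.
  by apply: (wkl); apply: (wk); exact: le_refl.
- exact: le0x.
- apply/(residuation SH)/(residuation SH); rewrite -(meetA SH); exact: mpx.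
- apply/(residuation SH); rewrite (meetA SH).
  by apply/(residuation SH)/mpx.
- apply/(residuation SH)/(residuation SH); set t := impH _ _ ⊓ impH _ _.
  rewrite (imp_relE SH (x' := eval v b) (y' := eval v c)) //; first exact: le_meetr.
  by apply: (impH_meetE SH); [exact: le_meetl|exact: le_meetr].
- apply/(residuation SH)/(residuation SH); set t := impH _ _ ⊓ impH _ _.
  rewrite (imp_relE SH (x' := eval v c) (y' := eval v a)) //; first exact: le_meetr.
  by symmetry; apply: (impH_meetE SH); [exact: le_meetl|exact: le_meetr].
- by rewrite (neg0 H); exact: le_refl.
- by rewrite (neg1 H); exact: le_refl.
- by rewrite (neg_meet H); exact: le_refl.
Qed.

Lemma derives_sound (Ax G : set form) p :
  (forall d, Ax d -> satisfies_eq A d ⊤%F) ->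
  (forall d, G d -> satisfies_eq A d ⊤%F) ->
  derives Ax G p -> satisfies_eq A p ⊤%F.
Proof.
move=> hAx hG; elim=> {p} [p|p|p q _ hp _ hpq|p q _ hpq].
- exact: hAx.
- exact: hG.
- move=> v; have := hpq v; rewrite eval_impH hp => /(impH_eq1 SH).
  exact: le1_eq.
- move=> v; have := hpq v; rewrite !eval_impH => /(impH_eq1 SH) le_pq.
  exact/(impH_eq1 SH)/neg_anti.
Qed.

End Soundness.

(** * Lindenbaum algebras *)

(** The sets of formulas that contain the axioms of the base logic and are
    closed under its two rules. *)
Record is_theory (T : set form) : Prop := {
  theory_ax : DHMSH_axiom `<=` T;
  theory_mp : forall p q, T p -> T (p →H q)%F -> T q;
  theory_cp : forall p q, T (p →H q)%F -> T (∼ q →H ∼ p)%F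
}.

Section Lindenbaum.
Variables (T : set form) (TT : is_theory T).
Implicit Types p q r s : form.

Let mp := theory_mp TT.

(** Provable implication, a preorder on formulas, and its equivalence. *)
Definition entails p q : Prop := T (p →H q)%F.
Definition equivalent p q : Prop := entails p q /\ entails q p.

Local Notation "p ⊢ q" := (entails p q) (at level 70, no associativity).
Local Notation "p ≡ q" := (equivalent p q) (at level 70, no associativity).

Lemma entails_projl p q : (p ∧ q)%F ⊢ p.
Proof. by apply: (theory_ax TT); exact: A4. Qed.

Lemma entails_curry p q r : (p ∧ q)%F ⊢ r -> p ⊢ (q →H r)%F.
Proof. by move=> h; apply: (mp h _); apply: (theory_ax TT); exact: A8. Qed.

Lemma entails_uncurry p q r : p ⊢ (q →H r)%F -> (p ∧ q)%F ⊢ r.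
Proof. by move=> h; apply: (mp h _); apply: (theory_ax TT); exact: A9. Qed.

Lemma entails_weaken p q : T p -> q ⊢ p.
Proof. by move=> h; apply: (mp h _); apply: entails_curry; exact: entails_projl. Qed.

Lemma entails_pair p q r : r ⊢ p -> r ⊢ q -> r ⊢ (p ∧ q)%F.
Proof.
by move=> rp rq; apply: (mp rq _); apply: (mp rp _); apply: (theory_ax TT); exact: A5.
Qed.

Lemma entails_meetr p q r : p ⊢ q -> (r ∧ p)%F ⊢ q.
Proof. by move=> h; apply: entails_uncurry; exact: entails_weaken. Qed.

Lemma imp_congr p q r : q ≡ r -> (p → q)%F ⊢ (p → r)%F.
Proof.
case=> qr rq; apply: (mp qr _); apply: (mp rq _); apply: (theory_ax TT).
exact: A11.
Qed.

Lemma imp_congl p q r : p ≡ q -> (p → r)%F ⊢ (q → r)%F.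
Proof.
by case=> pq qp; apply: (mp qp _); apply: (mp pq _); apply: (theory_ax TT); exact: A10.
Qed.

(* [p →H p] is [p → p ∧ p], and [p ∧ p] is equivalent to [p ∧ ⊤], where
   [p → p ∧ ⊤] is provable. *)
Lemma entails_refl p : p ⊢ p.
Proof.
have ptop : p ⊢ ⊤%F by apply: entails_weaken; apply: (theory_ax TT); exact: A6.
apply: (mp ptop _); apply: imp_congr; split.
  by apply: entails_pair; exact: entails_projl.
by apply: entails_pair; [exact: entails_projl|exact: entails_meetr].
Qed.

Lemma entails_projr p q : (p ∧ q)%F ⊢ q.
Proof. by apply: entails_meetr; exact: entails_refl. Qed.

(* [x → x ∧ y] is provable, and [x ∧ z] is reached from [x ∧ y] through
   [z ∧ x]; no step uses transitivity. *)
Lemma entails_trans y x z : x ⊢ y -> y ⊢ z -> x ⊢ z.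
Proof.
move=> xy yz.
have : T (x → z ∧ x)%F.
  apply: (mp xy _); apply: imp_congr; split; apply: entails_pair.
  - exact: entails_meetr.
  - exact: entails_projl.
  - exact: entails_projr.
  - exact: entails_meetr.
move=> h; apply: (mp h _); apply: imp_congr.
by split; apply: entails_pair; (exact: entails_projl || exact: entails_projr).
Qed.

Lemma theory_entails p : T p <-> ⊤%F ⊢ p.
Proof.
split; first exact: entails_weaken.
by move=> h; apply: mp h; apply: (theory_ax TT); exact: A6.
Qed.

Lemma entails_top p : p ⊢ ⊤%F.
Proof. by apply: entails_weaken; apply: (theory_ax TT); exact: A6. Qed.

Lemma entails_bot p : ⊥%F ⊢ p.
Proof. by apply: (theory_ax TT); exact: A7. Qed.

Lemma entails_joinl p q : p ⊢ (p ∨ q)%F.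
Proof. by apply: (theory_ax TT); exact: A1. Qed.

Lemma entails_joinr p q : q ⊢ (p ∨ q)%F.
Proof. by apply: (theory_ax TT); exact: A2. Qed.

Lemma entails_join p q r : p ⊢ r -> q ⊢ r -> (p ∨ q)%F ⊢ r.
Proof.
by move=> pr qr; apply: (mp qr _); apply: (mp pr _); apply: (theory_ax TT); exact: A3.
Qed.

Lemma entails_mp p q r : r ⊢ p -> r ⊢ (p →H q)%F -> r ⊢ q.
Proof.
move=> rp /entails_uncurry; apply: entails_trans.
by apply: entails_pair => //; exact: entails_refl.
Qed.

Lemma entails_imp_congl p q r s :
  s ⊢ (p →H q)%F -> s ⊢ (q →H p)%F -> (s ∧ (p → r))%F ⊢ (q → r)%F.
Proof.
move=> pq qp; apply: entails_uncurry; apply: entails_mp qp _.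
apply: entails_mp pq _; apply: entails_weaken; apply: (theory_ax TT); exact: A10.
Qed.

Lemma entails_imp_congr p q r s :
  s ⊢ (q →H r)%F -> s ⊢ (r →H q)%F -> (s ∧ (p → q))%F ⊢ (p → r)%F.
Proof.
move=> qr rq; apply: entails_uncurry; apply: entails_mp qr _.
apply: entails_mp rq _; apply: entails_weaken; apply: (theory_ax TT); exact: A11.
Qed.

Lemma equivalent_refl p : p ≡ p.
Proof. by split; exact: entails_refl. Qed.

Lemma equivalent_sym p q : p ≡ q -> q ≡ p.
Proof. by case. Qed.

Lemma equivalent_trans q p r : p ≡ q -> q ≡ r -> p ≡ r.
Proof.
by move=> [pq qp] [qr rq]; split; [exact: entails_trans qr|exact: entails_trans qp].
Qed.

Lemma equivalent_meet p p' q q' : p ≡ p' -> q ≡ q' -> (p ∧ q)%F ≡ (p' ∧ q')%F.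
Proof.
move=> [pp' p'p] [qq' q'q]; split; apply: entails_pair.
- exact: entails_trans (entails_projl _ _) _.
- exact: entails_trans (entails_projr _ _) _.
- exact: entails_trans (entails_projl _ _) _.
- exact: entails_trans (entails_projr _ _) _.
Qed.

Lemma equivalent_join p p' q q' : p ≡ p' -> q ≡ q' -> (p ∨ q)%F ≡ (p' ∨ q')%F.
Proof.
move=> [pp' p'p] [qq' q'q]; split; apply: entails_join.
- exact: entails_trans (entails_joinl _ _).
- exact: entails_trans (entails_joinr _ _).
- exact: entails_trans (entails_joinl _ _).
- exact: entails_trans (entails_joinr _ _).
Qed.

Lemma equivalent_imp p p' q q' : p ≡ p' -> q ≡ q' -> (p → q)%F ≡ (p' → q')%F.
Proof.
move=> pp' qq'; split.
  exact: entails_trans (imp_congl _ pp') (imp_congr _ qq').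
exact: entails_trans (imp_congl _ (equivalent_sym pp'))
  (imp_congr _ (equivalent_sym qq')).
Qed.

Lemma equivalent_neg p q : p ≡ q -> (∼ p)%F ≡ (∼ q)%F.
Proof. by case=> pq qp; split; exact: (theory_cp TT). Qed.

(* Below [p], the antecedent [p] may be replaced by [⊤], and [⊤ → q] is
   equivalent to [⊤ →H q], hence to [q]. *)
Lemma meet_impF p q : (p ∧ (p → q))%F ≡ (p ∧ q)%F.
Proof.
have top_imp r : (⊤ → r)%F ≡ r.
  have : (⊤ → r)%F ≡ (⊤ →H r)%F.
    apply: equivalent_imp; first exact: equivalent_refl.
    split; last exact: entails_projr.
    by apply: entails_pair; [exact: entails_top|exact: entails_refl].
  move=> h; apply: equivalent_trans h _; split.
    apply: entails_mp (entails_top _) _; exact: entails_refl.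
  by apply: entails_curry; exact: entails_projl.
have [ptop topp] : p ⊢ (p →H ⊤)%F /\ p ⊢ (⊤ →H p)%F.
  split; apply: entails_curry; first exact: entails_top.
  exact: entails_projl.
split; (apply: entails_pair; first exact: entails_projl).
  by apply: entails_trans (entails_imp_congl q ptop topp) _; case: (top_imp q).
apply: entails_trans (entails_imp_congl q topp ptop).
apply: entails_pair; first exact: entails_projl.
by apply: entails_trans (entails_projr _ _) _; case: (top_imp q).
Qed.

Lemma meet_imp_relF p q r :
  (p ∧ (q → r))%F ≡ (p ∧ ((p ∧ q) → (p ∧ r)))%F.
Proof.
have h s : p ⊢ (s →H (p ∧ s))%F /\ p ⊢ ((p ∧ s) →H s)%F.
  split; apply: entails_curry; first exact: entails_refl.
  exact: entails_trans (entails_projr _ _) (entails_projr _ _).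
have [q1 q2] := h q; have [r1 r2] := h r.
split; (apply: entails_pair; first exact: entails_projl).
  apply: entails_trans (entails_imp_congr (p ∧ q) r1 r2).
  by apply: entails_pair; [exact: entails_projl|exact: entails_imp_congl].
apply: entails_trans (entails_imp_congr q r2 r1).
by apply: entails_pair; [exact: entails_projl|exact: entails_imp_congl].
Qed.

(** The Lindenbaum algebra: the elements are the classes of formulas modulo
    provable equivalence, given as sets of formulas. *)
Definition lindenbaum_carrier : Type :=
  {S : set form | exists p, S = equivalent p}.

Definition cl p : lindenbaum_carrier :=
  exist _ (equivalent p) (ex_intro _ p erefl).

(** A chosen formula of a class. *)
Definition repr (c : lindenbaum_carrier) : form := sval (cid (svalP c)).

Definition lindenbaum : algebra := {|
  carrier := lindenbaum_carrier;
  ajoin c d := cl (repr c ∨ repr d);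
  ameet c d := cl (repr c ∧ repr d);
  aimp c d := cl (repr c → repr d);
  aneg c := cl (∼ repr c);
  azero := cl ⊥;
  aone := cl ⊤
|}.

Lemma clP p q : cl p = cl q <-> p ≡ q.
Proof.
split=> [/(congr1 sval) /= e|pq].
  by rewrite e; exact: equivalent_refl.
apply: (eq_sig_hprop (fun=> @Prop_irrelevance _)).
apply/funext => r; apply/propext; split.
  exact: equivalent_trans (equivalent_sym pq).
exact: equivalent_trans pq.
Qed.

Lemma reprK c : cl (repr c) = c.
Proof.
by apply: (eq_sig_hprop (fun=> @Prop_irrelevance _)); rewrite /= /repr; case: cid.
Qed.

Lemma repr_cl p : repr (cl p) ≡ p.
Proof. by apply/clP; exact: reprK. Qed.

Lemma cl_join p q : ajoin (cl p : lindenbaum) (cl q) = cl (p ∨ q).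
Proof. by apply/clP; apply: equivalent_join; exact: repr_cl. Qed.

Lemma cl_meet p q : ameet (cl p : lindenbaum) (cl q) = cl (p ∧ q).
Proof. by apply/clP; apply: equivalent_meet; exact: repr_cl. Qed.

Lemma cl_imp p q : aimp (cl p : lindenbaum) (cl q) = cl (p → q).
Proof. by apply/clP; apply: equivalent_imp; exact: repr_cl. Qed.

Lemma cl_neg p : aneg (cl p : lindenbaum) = cl (∼ p).
Proof. by apply/clP; apply: equivalent_neg; exact: repr_cl. Qed.

Definition clE := (cl_join, cl_meet, cl_imp, cl_neg).

Lemma eval_cl (s : nat -> form) p :
  eval (fun n => cl (s n) : lindenbaum) p = cl (subst s p).
Proof.
elim: p => [n|p IHp q IHq|p IHp q IHq|p IHp q IHq|p IHp||] //;
  rewrite [LHS]/= IHp ?IHq.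
- exact: cl_join.
- exact: cl_meet.
- exact: cl_imp.
- exact: cl_neg.
Qed.

Lemma cl_top p : cl p = cl ⊤ <-> T p.
Proof.
rewrite clP theory_entails; split=> [[]//|h].
by split=> //; exact: entails_top.
Qed.

Lemma lindenbaum_satisfies p :
  satisfies_eq lindenbaum p ⊤%F <-> forall s : nat -> form, T (subst s p).
Proof.
split=> [h s|h v]; first by apply/cl_top; rewrite -eval_cl h.
have -> : v = fun n => cl (repr (v n)) by apply/funext => n; rewrite reprK.
by rewrite eval_cl; exact/cl_top.
Qed.

Lemma lindenbaum_DHMSH : DHMSH lindenbaum.
Proof.
have cl_ex (c : lindenbaum) : exists p, c = cl p.
  by exists (repr c); rewrite reprK.
have pl2 p q r : p ⊢ r -> (p ∧ q)%F ⊢ r.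
  by apply: entails_trans; exact: entails_projl.
have pr2 p q r : q ⊢ r -> (p ∧ q)%F ⊢ r.
  by apply: entails_trans; exact: entails_projr.
have jl2 p q r : r ⊢ p -> r ⊢ (p ∨ q)%F.
  by move=> h; exact: entails_trans h (entails_joinl _ _).
have jr2 p q r : r ⊢ q -> r ⊢ (p ∨ q)%F.
  by move=> h; exact: entails_trans h (entails_joinr _ _).
have refl := entails_refl.
split; [split| | |]; move=> *;
  repeat match goal with c : carrier lindenbaum |- _ =>
    let p := fresh "p" in have [p ?] := cl_ex c; subst c end;
  rewrite ?clE; apply/clP.
- by split; apply: entails_join; eauto.
- by split; apply: entails_pair; eauto.
- by split; repeat apply: entails_join; eauto.
- by split; repeat apply: entails_pair; eauto.
- by split; [apply: entails_join|]; eauto.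
- by split; [|apply: entails_pair]; eauto.
- by split; [apply: entails_join|]; eauto using entails_bot.
- by split; [|apply: entails_pair]; eauto using entails_top.
- exact: meet_impF.
- exact: meet_imp_relF.
- split; first exact: entails_top.
  apply: entails_weaken; apply: (mp (entails_refl _) _).
  apply: imp_congr; split; first exact: entails_projl.
  by apply: entails_pair; exact: entails_refl.
- by split; [exact: entails_top|apply: (theory_ax TT); exact: A12].
- by split; [apply: (theory_ax TT); exact: A13|exact: entails_bot].
- split; first by apply: (theory_ax TT); exact: A14.
  by apply: entails_join; apply: (theory_cp TT);
    [exact: entails_projl|exact: entails_projr].
Qed.

End Lindenbaum.

(** * Axiomatic extensions and their varieties *)

Lemma subst_subst (s t : nat -> form) p :
  subst s (subst t p) = subst (fun n => subst s (t n)) p.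
Proof. by elim: p => //= [p -> q ->|p -> q ->|p -> q ->|p ->]. Qed.

Lemma subst_Var p : subst Var p = p.
Proof. by elim: p => //= [p -> q ->|p -> q ->|p -> q ->|p ->]. Qed.

Lemma DHMSH_axiom_subst s p : DHMSH_axiom p -> DHMSH_axiom (subst s p).
Proof. by case=> *; constructor. Qed.

Lemma instances_subst (X : set form) s p : instances X p -> instances X (subst s p).
Proof.
by move=> [t [x [Xx ->]]]; exists (fun n => subst s (t n)), x; rewrite subst_subst.
Qed.

Lemma instances_self (X : set form) : X `<=` instances X.
Proof. by move=> p Xp; exists Var, p; rewrite subst_Var. Qed.

Lemma derives_trans (Ax Ax' G : set form) :
  Ax `<=` derives Ax' G -> derives Ax G `<=` derives Ax' G.
Proof.
move=> sub p; elim=> {p} [p|p|p q _ hp _ hpq|p q _ hpq].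
- exact: sub.
- exact: Dpremise.
- exact: SMP hpq.
- exact: SCP.
Qed.

Lemma derives_mono (Ax G G' : set form) : G `<=` G' -> derives Ax G `<=` derives Ax G'.
Proof.
move=> sub p; elim=> {p} [p|p|p q _ hp _ hpq|p q _ hpq].
- exact: Daxiom.
- by move/sub; exact: Dpremise.
- exact: SMP hpq.
- exact: SCP.
Qed.

Lemma derives_subst (Ax : set form) s :
  (forall p, Ax p -> Ax (subst s p)) ->
  forall p, derives Ax set0 p -> derives Ax set0 (subst s p).
Proof.
move=> hAx p; elim=> {p} [p /hAx|p []|p q _ hp _ hpq|p q _ hpq].
- exact: Daxiom.
- exact: SMP hpq.
- exact: SCP.
Qed.

(** An axiomatic extension is determined by its theorems. *)
Lemma adjoin_theorems (L : logic) X :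
  adjoin L X = derives (theorems (adjoin L X)).
Proof.
apply/funext => G; apply/seteqP; split; apply: derives_trans => p h.
  by apply: Daxiom; apply: Daxiom.
exact: (derives_mono (@sub0set _ G)).
Qed.

Lemma adjoin_adjoin (L : logic) X Y : adjoin (adjoin L X) Y = adjoin L (X `|` Y).
Proof.
have inst_sub (U V : set form) : U `<=` V -> instances U `<=` instances V.
  by move=> UV p [s [x [Ux ->]]]; exists s, x; split => //; exact: UV.
apply/funext => G; apply/seteqP; split; apply: derives_trans => p.
  case=> [h|h].
    apply: (derives_mono (@sub0set _ G)); apply: derives_trans h => q [Lq|Xq].
      by apply: Daxiom; left.
    by apply: Daxiom; right; apply: inst_sub Xq; exact: subsetUl.
  by apply: Daxiom; right; apply: inst_sub h; exact: subsetUr.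
case=> [Lp|[s [x [[Xx|Yx] ->]]]]; apply: Daxiom.
- by left; apply: Daxiom; left.
- by left; apply: Daxiom; right; exists s, x.
- by right; exists s, x.
Qed.

Lemma theorems_extension_theory X : is_theory (theorems (adjoin DHMSH_logic X)).
Proof.
split=> [p hp|p q|p q].
- by apply: Daxiom; left; exact: Daxiom.
- exact: SMP.
- exact: SCP.
Qed.

Lemma theorems_extension_subst X s p :
  theorems (adjoin DHMSH_logic X) p -> theorems (adjoin DHMSH_logic X) (subst s p).
Proof.
apply: derives_subst => q [Lq|Xq]; last by right; exact: instances_subst.
by left; apply: derives_subst Lq; exact: DHMSH_axiom_subst.
Qed.

Lemma eval_subst (A : algebra) (v : nat -> A) s p :
  eval v (subst s p) = eval (fun n => eval v (s n)) p.
Proof. by elim: p => //= [p -> q ->|p -> q ->|p -> q ->|p ->]. Qed.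

Lemma extension_models (A : algebra) X : DHMSH A ->
  (forall d, X d -> satisfies_eq A d ⊤%F) <->
  (forall d, theorems (adjoin DHMSH_logic X) d -> satisfies_eq A d ⊤%F).
Proof.
move=> HA; split=> h d.
  apply: derives_sound => // {}d [hd|[s [x [Xx ->]]]] v; last first.
    by rewrite eval_subst h.
  by move: v; apply: (derives_sound HA (DHMSH_axiom_sound HA)) hd.
by move=> Xd; apply: h; apply: Daxiom; right; exact: instances_self.
Qed.

(** The Lindenbaum algebra of one extension is a model of it, hence of any
    extension that corresponds to the same class. *)
Lemma corresponds_theorems V E E' :
  corresponds V E -> corresponds V E' -> theorems E' `<=` theorems E.
Proof.
move=> [[X ->] VE] [_ VE'] p E'p.
set T := theorems _; have TT : is_theory T by exact: theorems_extension_theory.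
have V_T : V (lindenbaum T).
  apply/VE; split; first exact: lindenbaum_DHMSH.
  move=> d Td; apply/(lindenbaum_satisfies TT) => s.
  exact: theorems_extension_subst.
have [_ /(_ p E'p)] := (VE' _).1 V_T.
by move/(lindenbaum_satisfies TT)/(_ Var); rewrite subst_Var.
Qed.

Lemma is_logic_of_adjoin (V : algebra -> Prop) X :
  (forall A, V A <-> DHMSH A /\ forall d, X d -> satisfies_eq A d ⊤%F) ->
  is_logic_of V (adjoin DHMSH_logic X).
Proof.
move=> VX; have cV : corresponds V (adjoin DHMSH_logic X).
  split; first by exists X.
  move=> A; rewrite VX; split=> -[HA h]; split=> //.
    exact: ((extension_models X HA).1 h).
  exact: ((extension_models X HA).2 h).
split=> // E' cE'; have [[Y E'Y] _] := cE'.
have eqT : theorems (adjoin DHMSH_logic X) = theorems E'.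
  apply/seteqP; split; first exact: (corresponds_theorems cE' cV).
  exact: (corresponds_theorems cV cE').
by rewrite adjoin_theorems eqT E'Y -adjoin_theorems.
Qed.

(** * Varieties *)

Section Hom.
Variables (A B : algebra) (f : A -> B) (hf : hom f).

Lemma hom_eval (v : nat -> A) p : f (eval v p) = eval (fun n => f (v n)) p.
Proof.
by elim: p => //= [p IHp q IHq|p IHp q IHq|p IHp q IHq|p IHp||];
  rewrite ?(hom_join hf) ?(hom_meet hf) ?(hom_imp hf) ?(hom_neg hf) ?IHp ?IHq
          ?(hom_zero hf) ?(hom_one hf).
Qed.

Lemma satisfies_sub p q :
  injective f -> satisfies_eq B p q -> satisfies_eq A p q.
Proof. by move=> inj_f h v; apply: inj_f; rewrite !hom_eval. Qed.

Lemma satisfies_image p q :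
  (forall y, exists x, f x = y) -> satisfies_eq A p q -> satisfies_eq B p q.
Proof.
move=> /choice[g gK] h v.
have -> : v = fun n => f (g (v n)) by apply/funext => n; rewrite gK.
by rewrite -!hom_eval h.
Qed.
End Hom.

Lemma eval_prod (I : Type) (A : I -> algebra) (v : nat -> prod_algebra A) p i :
  eval v p i = eval (fun n => v n i) p.
Proof. by elim: p => //= [p -> q ->|p -> q ->|p -> q ->|p ->]. Qed.

Lemma satisfies_prod (I : Type) (A : I -> algebra) p q :
  (forall i, satisfies_eq (A i) p q) -> satisfies_eq (prod_algebra A) p q.
Proof.
by move=> h v; apply: functional_extensionality_dep => i; rewrite !eval_prod h.
Qed.

Lemma equational_class_variety (E : form -> form -> Prop) :
  variety (fun A => forall p q, E p q -> satisfies_eq A p q).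
Proof.
split=> [A B f hf surj_f hA p q /hA|A B f hf inj_f hB p q /hB|I A hA p q Epq].
- exact: (satisfies_image hf surj_f).
- exact: (satisfies_sub hf inj_f).
- by apply: satisfies_prod => i; exact: hA.
Qed.

Lemma DMBSH_variety : variety DMBSH.
Proof.
split=> [A B f hf surj_f|A B f hf inj_f|I A hA].
- case=> [[[]]] *; split; [split; [split| | |]| | |]; move=> *;
    repeat match goal with y : carrier B |- _ =>
      let x := fresh "x" in have [x ?] := surj_f y; subst y end;
    rewrite -?(hom_zero hf) -?(hom_one hf);
    rewrite -?(hom_neg hf) -?(hom_join hf) -?(hom_meet hf) -?(hom_imp hf);
    rewrite -?(hom_neg hf) -?(hom_join hf) -?(hom_meet hf) -?(hom_imp hf);
    rewrite -?(hom_neg hf) -?(hom_join hf) -?(hom_meet hf) -?(hom_imp hf);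
    by congr (f _); auto.
- case=> [[[]]] *; split; [split; [split| | |]| | |]; move=> *; apply: inj_f;
    rewrite ?(hom_neg hf, hom_join hf, hom_meet hf, hom_imp hf);
    rewrite ?(hom_zero hf, hom_one hf);
    auto.
- split; [split; [split| | |]| | |]; move=> *;
    apply: functional_extensionality_dep => i /=; have [[[]]] := hA i; auto.
Qed.

Lemma variety_and (K K' : algebra -> Prop) :
  variety K -> variety K' -> variety (fun A => K A /\ K' A).
Proof.
move=> vK vK'; split=> [A B f hf surj_f [KA K'A]|A B f hf inj_f [KB K'B]|I A KA].
- by split; [exact: (closed_image vK hf)|exact: (closed_image vK' hf)].
- by split; [exact: (closed_sub vK hf)|exact: (closed_sub vK' hf)].
- by split; [apply: (closed_prod vK)|apply: (closed_prod vK')] => i; case: (KA i).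
Qed.

(** An algebra separated by its homomorphisms into [D] embeds in a power of [D]. *)
Lemma separated_generated (D A : algebra) :
  (forall x y : A, x <> y -> exists f : A -> D, hom f /\ f x <> f y) ->
  generated_variety D A.
Proof.
move=> sep K vK KD.
pose I := {f : A -> D | hom f}.
pose g (x : A) : prod_algebra (fun _ : I => D) := fun f => sval f x.
have hg : hom g.
  by split=> *; apply: functional_extensionality_dep => -[f hf]; case: (hf) => /=.
apply: (closed_sub vK hg) => [x y gxy|]; last exact: (closed_prod vK).
apply: contrapT => /sep[f [hf]]; apply.
exact: (congr1 (fun h => h (exist _ f hf)) gxy).
Qed.

(** * Prime filters *)

(** A prime filter of a bounded lattice, given by its indicator function. *)
Record lattice_char (A : algebra) (h : A -> bool) : Prop := {
  char_join : forall x y, h (x ⊔ y) = h x || h y;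
  char_meet : forall x y, h (x ⊓ y) = h x && h y;
  char0 : h azero = false;
  char1 : h aone = true
}.

Section PrimeFilter.
Variables (A : algebra) (H : semiHeyting A).
Implicit Types x y z : A.

(** Filters, possibly empty. *)
Definition is_filter (F : set A) : Prop :=
  (forall x y, F x -> x ≼ y -> F y) /\ (forall x y, F x -> F y -> F (x ⊓ y)).

Lemma prime_filter_char x y :
  ~ x ≼ y -> exists h : A -> bool, [/\ lattice_char h, h x & ~~ h y].
Proof.
move=> nxy.
(* The extension by the principal filter of [x] lets the empty chain have an
   upper bound. *)
pose up (F : set A) := [set z | x ≼ z] `|` F.
pose P (F : set A) := is_filter (up F) /\ ~ up F y.
have [|F [[[upF meetF] nFy] maxF]] := @Zorn_bigcup A P.
  move=> C CP totC.
  have in_up X z : C X -> up X z -> up (\bigcup_(X in C) X) z.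
    by move=> CX [xz|Xz]; [left|right; exists X].
  have out_up z : up (\bigcup_(X in C) X) z -> x ≼ z \/ exists2 X, C X & up X z.
    by case=> [xz|[X CX Xz]]; [left|right; exists X => //; right].
  split; last by move/out_up => [//|[X /CP[_ nXy]]].
  split=> u v.
    move=> /out_up[xu|[X CX Xu]] uv; first by left; exact: (le_trans H xu uv).
    by apply: (in_up _ _ CX); have [[upX _] _] := CP _ CX; exact: upX uv.
  move=> /out_up[xu|[X CX Xu]] /out_up[xv|[Y CY Yv]].
  - by left; exact: le_meet.
  - apply: (in_up _ _ CY); have [[_ meetY] _] := CP _ CY.
    by apply: meetY => //; left.
  - apply: (in_up _ _ CX); have [[_ meetX] _] := CP _ CX.
    by apply: meetX => //; left.
  have up_mono (U V : set A) z : U `<=` V -> up U z -> up V z.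
    by move=> UV [|/UV]; [left|right].
  have [XY|YX] := totC _ _ CX CY.
    apply: (in_up _ _ CY); have [[_ meetY] _] := CP _ CY.
    by apply: meetY => //; exact: up_mono Xu.
  apply: (in_up _ _ CX); have [[_ meetX] _] := CP _ CX.
  by apply: meetX => //; exact: up_mono Yv.
have Fx : up F x by left; exact: le_refl.
have F1 : up F aone by apply: upF Fx _; exact: lex1.
(* By maximality, the filter generated by [up F] and an outside element [a]
   contains [y]. *)
have out a : ~ up F a -> exists2 f, up F f & f ⊓ a ≼ y.
  move=> nFa; pose G := [set z | exists2 f, up F f & f ⊓ a ≼ z].
  apply: contrapT => nGy.
  have FG z : up F z -> G z by move=> Fz; exists z => //; exact: le_meetl.
  have upG : up G = G.
    apply/seteqP; split=> z; last by right.
    by case=> // xz; apply: FG; left.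
  apply: (maxF G).
    split=> [z Fz|Fa]; first by apply: FG; right.
    by apply: nFa; right; apply: Fa; exists aone => //; exact: le_meetr.
  split; rewrite upG //; split=> [u v [f Ff fu] uv|u v [f Ff fu] [g Fg gv]].
    by exists f => //; exact: (le_trans H fu uv).
  exists (f ⊓ g); first exact: meetF.
  apply: le_meet => //.
    apply: (le_trans H _ fu); apply: le_meet => //; last exact: le_meetr.
    exact: (le_trans H (le_meetl H _ _) (le_meetl H _ _)).
  apply: (le_trans H _ gv); apply: le_meet => //; last exact: le_meetr.
  exact: (le_trans H (le_meetl H _ _) (le_meetr H _ _)).
exists (fun z => `[< up F z >]); split; [split|exact/asboolP|exact/asboolP].
- move=> a b; apply/asboolP/orP; last first.
    by case=> /asboolP h; apply: upF h _; [exact: le_joinl|exact: le_joinr].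
  move=> Fab; have [Fa|/out[f Ff fa]] := pselect (up F a); first by left; apply/asboolP.
  have [Fb|/out[g Fg gb]] := pselect (up F b); first by right; apply/asboolP.
  case: nFy; apply: upF (meetF _ _ (meetF _ _ Ff Fg) Fab) _.
  apply: meet_join_le => //.
    apply: (le_trans H _ fa); apply: le_meet => //; last exact: le_meetr.
    exact: (le_trans H (le_meetl H _ _) (le_meetl H _ _)).
  apply: (le_trans H _ gb); apply: le_meet => //; last exact: le_meetr.
  exact: (le_trans H (le_meetl H _ _) (le_meetr H _ _)).
- move=> a b; apply/asboolP/andP => [Fab|[/asboolP Fa /asboolP Fb]]; last exact: meetF.
  by split; apply/asboolP; apply: upF Fab _; [exact: le_meetl|exact: le_meetr].
- by apply/asboolP => F0; apply: nFy; apply: upF F0 _; exact: le0x.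
- exact/asboolP.
Qed.

Lemma char_separates x y :
  x <> y -> exists2 h : A -> bool, lattice_char h & h x <> h y.
Proof.
move=> nxy; have [xy|] := pselect (x ≼ y); last first.
  by move/prime_filter_char => [h [hh hx /negP hy]]; exists h; rewrite // hx => /esym.
have : ~ y ≼ x by move=> yx; apply: nxy; exact: le_anti.
by move/prime_filter_char => [h [hh hy /negP hx]]; exists h; rewrite // hy.
Qed.

End PrimeFilter.

(** * De Morgan Boolean semi-Heyting algebras *)

Section Boolean.
Variables (A : algebra) (H : DMBSH A).
Let DH : DHMSH A := DMBSH_DHMSH H.
Let SH : semiHeyting A := DHMSH_semiHeyting DH.
Variables (h : A -> bool) (hh : lattice_char h).
Implicit Types x y z : A.

Lemma char_compl x : h (x ⇒ azero) = ~~ h x.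
Proof.
have := char_join hh x (x ⇒ azero); have := char_meet hh x (x ⇒ azero).
rewrite (join_compl H) (meet_imp SH) (meetx0 SH) (char0 hh) (char1 hh).
by case: (h x); case: (h _).
Qed.

Lemma char_rel z x x' y y' : h z -> z ⊓ x = z ⊓ x' -> z ⊓ y = z ⊓ y' ->
  h (x ⇒ y) = h (x' ⇒ y').
Proof.
move=> hz ex ey; have /(congr1 h) := imp_relE SH ex ey.
by rewrite !(char_meet hh) hz.
Qed.

(** In a Boolean semi-Heyting algebra the implication is determined by the
    lattice and the element [0 ⇒ 1]. *)
Lemma char_imp x y :
  h (x ⇒ y) = if h x then h y else ~~ h y || h (azero ⇒ aone).
Proof.
have meet_compl z : (z ⇒ azero) ⊓ z = azero.
  by rewrite (meetC SH) (meet_imp SH) (meetx0 SH).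
case hx: (h x).
  by have /(congr1 h) := meet_imp SH x y; rewrite !(char_meet hh) hx.
have -> : h (x ⇒ y) = h (azero ⇒ y).
  apply: (@char_rel (x ⇒ azero)) => //; first by rewrite char_compl hx.
  by rewrite meet_compl (meetx0 SH).
case hy: (h y) => /=.
  apply: (@char_rel y) => //.
  by rewrite (meetxx SH) (meet1 SH).
have -> : h (azero ⇒ y) = h (azero ⇒ azero).
  apply: (@char_rel (y ⇒ azero)) => //; first by rewrite char_compl hy.
  by rewrite meet_compl (meetx0 SH).
by rewrite char_compl (char0 hh).
Qed.

(** The composite of a character with the involution [x ↦ (x')*]. *)
Lemma char_dual : lattice_char (fun x => ~~ h (aneg x)).
Proof.
split=> [x y|x y||].
- by rewrite (neg_join H) (char_meet hh) negb_and.
- by rewrite (neg_meet DH) (char_join hh) negb_or.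
- by rewrite (neg0 DH) (char1 hh).
- by rewrite (neg1 DH) (char0 hh).
Qed.

End Boolean.

(** The two coordinates on the four-element Boolean lattice: [a] is [(1, 0)] and
    [b] is [(0, 1)]. *)
Definition four_fst (x : four) : bool := if x is (e1 | ea) then true else false.
Definition four_snd (x : four) : bool := if x is (e1 | eb) then true else false.
Definition four_pair (p q : bool) : four :=
  if p then (if q then e1 else ea) else (if q then eb else e0).

(** The map into the four-element lattice attached to [h]. Its second coordinate
    is the dual of [h], which makes it commute with the negations. *)
Definition char_map (A : algebra) (h : A -> bool) (x : A) : four :=
  four_pair (h x) (~~ h (aneg x)).

Lemma char_map_eq (A : algebra) (h : A -> bool) x y :
  char_map h x = char_map h y -> h x = h y /\ h (aneg x) = h (aneg y).
Proof.
by rewrite /char_map; case: (h x); case: (h y); case: (h _); case: (h _).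
Qed.

Lemma char_map_hom (imp : four -> four -> four) (A : algebra) (h : A -> bool) :
  DMBSH (four_algebra imp) -> DMBSH A -> lattice_char h ->
  char_map h (azero ⇒ aone) = imp e0 e1 ->
  hom (char_map h : A -> four_algebra imp).
Proof.
move=> HD HA hh hc.
have DA := DMBSH_DHMSH HA.
have h2 := char_dual HA hh.
have fstD : lattice_char (four_fst : four_algebra imp -> bool).
  by split=> //; do 2 case.
have sndD : lattice_char (four_snd : four_algebra imp -> bool).
  by split=> //; do 2 case.
have ext (s t : four) : four_fst s = four_fst t -> four_snd s = four_snd t -> s = t.
  by case: s; case: t.
have fst_pair p q : four_fst (four_pair p q) = p by case: p; case: q.
have snd_pair p q : four_snd (four_pair p q) = q by case: p; case: q.
split=> [x y|x y|x y|x||].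
- apply: ext; rewrite ?(char_join fstD) ?(char_join sndD) !(fst_pair, snd_pair).
    exact: char_join.
  exact: (char_join h2).
- apply: ext; rewrite ?(char_meet fstD) ?(char_meet sndD) !(fst_pair, snd_pair).
    exact: char_meet.
  exact: (char_meet h2).
- apply: ext.
    rewrite [RHS](char_imp HD fstD (char_map h x) (char_map h y)) /= -hc !fst_pair.
    exact: char_imp.
  rewrite [RHS](char_imp HD sndD (char_map h x) (char_map h y)) /= -hc !snd_pair.
  exact: (char_imp HA h2).
- rewrite /char_map (negK HA) /=.
  by case: (h x); case: (h (aneg x)).
- by rewrite /char_map (neg0 DA) (char0 hh) (char1 hh).
- by rewrite /char_map (neg1 DA) (char0 hh) (char1 hh).
Qed.

(** The second alternative serves algebras where only the dual of [h] gives a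
    homomorphism; both maps involve [h x] and [h x'], so both separate points. *)
Lemma four_generated (imp : four -> four -> four) (A : algebra) :
  DMBSH (four_algebra imp) -> DMBSH A ->
  (forall h : A -> bool, lattice_char h ->
     char_map h (azero ⇒ aone) = imp e0 e1 \/
     char_map (fun x => ~~ h (aneg x)) (azero ⇒ aone) = imp e0 e1) ->
  generated_variety (four_algebra imp) A.
Proof.
move=> HD HA hc; apply: separated_generated => x y nxy.
have [h hh hxy] := char_separates (DHMSH_semiHeyting (DMBSH_DHMSH HA)) nxy.
have [h_c|h_c] := hc h hh.
  by exists (char_map h); split; [exact: char_map_hom|move=> /char_map_eq[]].
exists (char_map (fun x => ~~ h (aneg x))); split.
  by apply: char_map_hom => //; exact: char_dual.
by move=> /char_map_eq[_]; rewrite !(negK HA) => /negb_inj.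
Qed.

Lemma D1_DMBSH : DMBSH D1.
Proof.
split; [split; [split| | |]| | |];
  solve [by [] | by case | by do 2 case | by do 3 case].
Qed.

Lemma D2_DMBSH : DMBSH D2.
Proof.
split; [split; [split| | |]| | |];
  solve [by [] | by case | by do 2 case | by do 3 case].
Qed.

Lemma D3_DMBSH : DMBSH D3.
Proof.
split; [split; [split| | |]| | |];
  solve [by [] | by case | by do 2 case | by do 3 case].
Qed.

(** Formulas that define the De Morgan Boolean algebras among the dually
    hemimorphic semi-Heyting algebras. *)
Definition DMBSH_formulas : set form :=
  [set (∼ (Var 0 ∨ Var 1) ⇔H (∼ Var 0 ∧ ∼ Var 1))%F;
       (∼ ∼ Var 0 ⇔H Var 0)%F;
       (Var 0 ∨ (Var 0 → ⊥))%F].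

Lemma DMBSH_formulasP (A : algebra) :
  DMBSH A <-> DHMSH A /\ forall d, DMBSH_formulas d -> satisfies_eq A d ⊤%F.
Proof.
split=> [HA|[HA h]].
  have DA := DMBSH_DHMSH HA; split=> // _ [[->|->]|->] v.
  - by apply/(eval_iffH_eq1 DA); exact: (neg_join HA).
  - by apply/(eval_iffH_eq1 DA); exact: (negK HA).
  - exact: (join_compl HA).
split=> // [x y|x|x].
- have /(_ (fun n => if n is 0 then x else y)) := h _ (or_introl (or_introl erefl)).
  by move/(eval_iffH_eq1 HA).
- have /(_ (fun _ => x)) := h _ (or_introl (or_intror erefl)).
  by move/(eval_iffH_eq1 HA).
- exact: (h _ (or_intror erefl) (fun _ => x)).
Qed.

(** If the schema [d] holds in [D] and every De Morgan Boolean algebra that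
    satisfies [d] is in the variety generated by [D], then [d] defines the logic
    of this variety. *)
Lemma is_logic_of_generated (D : algebra) (d : form) :
  DMBSH D -> satisfies_eq D d ⊤%F ->
  (forall A, DMBSH A -> satisfies_eq A d ⊤%F -> generated_variety D A) ->
  is_logic_of (generated_variety D)
    (adjoin (adjoin DHMSH_logic DMBSH_formulas) [set d]).
Proof.
move=> HD Dd gen; rewrite adjoin_adjoin; apply: is_logic_of_adjoin => A.
have := DMBSH_formulasP A; split=> [genA|[DA h]].
  have /genA[] : variety (fun B => DMBSH B /\
      forall p q, (p = d /\ q = ⊤%F) -> satisfies_eq B p q).
    exact: variety_and DMBSH_variety (equational_class_variety _).
  - by split=> // p q [-> ->].
  - move=> HA hd; have [DA hA] := (DMBSH_formulasP A).1 HA.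
    by split=> // e [/hA//|->]; apply: hd.
apply: gen; last by apply: h; right.
by apply/DMBSH_formulasP; split=> // e he; apply: h; left.
Qed.

Theorem corollary7p19 :
  exists LDMBSH L1 L2 L3 : logic,
    (is_logic_of DMBSH LDMBSH /\
     is_logic_of (generated_variety D1) L1 /\
     is_logic_of (generated_variety D2) L2 /\
     is_logic_of (generated_variety D3) L3) /\
    L1 = adjoin LDMBSH [set ((⊥ → ⊤) →H ⊥)%F] /\
    L2 = adjoin LDMBSH [set (⊥ → ⊤)%F] /\
    L3 = adjoin LDMBSH [set (∼ (⊥ → ⊤) ⇔H (⊥ → ⊤))%F].
Proof.
exists (adjoin DHMSH_logic DMBSH_formulas); do 3 eexists.
split; last by split; [|split].
split; first by apply: is_logic_of_adjoin; exact: DMBSH_formulasP.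
split; [|split]; [apply: (is_logic_of_generated D1_DMBSH)
  |apply: (is_logic_of_generated D2_DMBSH)
  |apply: (is_logic_of_generated D3_DMBSH)] => //.
- move=> A HA hd; have DA := DMBSH_DHMSH HA; have SA := DHMSH_semiHeyting DA.
  apply: (four_generated D1_DMBSH HA) => h hh; left.
  have c0 : azero ⇒ aone = azero :> A.
    apply: (le_anti SA); last exact: le0x.
    exact/(impH_eq1 SA)/(hd (fun=> azero)).
  by rewrite /char_map c0 (neg0 DA) (char0 hh) (char1 hh).
- move=> A HA hd; have DA := DMBSH_DHMSH HA.
  apply: (four_generated D2_DMBSH HA) => h hh; left.
  have c1 : azero ⇒ aone = aone :> A by exact: (hd (fun=> azero)).
  by rewrite /char_map c1 (neg1 DA) (char0 hh) (char1 hh).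
- move=> A HA hd; have DA := DMBSH_DHMSH HA.
  apply: (four_generated D3_DMBSH HA) => h hh.
  have cc : aneg (azero ⇒ aone) = azero ⇒ aone :> A.
    exact: ((eval_iffH_eq1 DA (fun=> azero) (∼ (⊥ → ⊤)) (⊥ → ⊤)).1 (hd _)).
  (* The value of [c] under [h] decides between [a], the value of [0 ⇒ 1] in
     the four-element algebra, and [b]; the dual of [h] exchanges them. *)
  by rewrite /char_map !cc; case: (h _); [left|right].
Qed.
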